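(* Let $\mathcal{C}$ be a combinatorial affine plane on a finite set $E$ with $\mathrm{bn}(\mathcal{C})\ge 3$. Then there is no clutter $\mathcal{D}$ on $E$ that is ideal, minimally non-packing, and satisfies $\tilde{\mathcal{D}}=\mathcal{C}$.
   Context: A clutter on a finite set $E$ is a family $\mathcal{C}\subseteq 2^E$ such that no member contains another; members are called hyperedges. A transversal of $\mathcal{C}$ is an inclusion-minimal subset of $E$ meeting every hyperedge; $\mathrm{b}(\mathcal{C})$ denotes the set of transversals, $\mathrm{bn}(\mathcal{C})$ (blocking number) the minimum size of a transversal, and $\mathrm{minb}(\mathcal{C})$ the set of transversals of size $\mathrm{bn}(\mathcal{C})$. The packing number $\mathrm{pn}(\mathcal{C})$ is the maximum number of pairwise disjoint hyperedges; $\mathcal{C}$ packs if $\mathrm{pn}(\mathcal{C})=\mathrm{bn}(\mathcal{C})$. For $A\subseteq E$, the contraction is $\mathcal{C}/A=$ the inclusion-minimal members of $\{X\setminus A: X\in\mathcal{C}\}$ and the deletion is $\mathcal{C}\setminus A=\{X\in\mathcal{C}: X\cap A=\emptyset\}$; a minor is obtained by iterating these, and a proper minor is a minor different from the clutter. $\mathcal{C}$ is minimally non-packing if it does not pack but every proper minor packs. $\mathcal{C}$ is ideal if the polyhedron $\{x\in\mathbb{R}^E: x\ge 0,\ \langle x,1_H\rangle\ge 1\ \forall H\in\mathcal{C}\}$ is integral ($1_H$ the incidence vector). $\tilde{\mathcal{C}}=\{H\in\mathcal{C}: |H\cap B|=1 \text{ for all } B\in\mathrm{minb}(\mathcal{C})\}$.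 A clutter $\mathcal{C}$ on $E$ is a combinatorial affine plane if (1) any two distinct hyperedges $H,H'$ satisfy $|H\cap H'|=1$; (2) for every element $a$ and hyperedge $H$ with $a\notin H$ there is a unique $b\in H$ such that no hyperedge contains both $a$ and $b$; (3) there exist three hyperedges with no element common to all three. *)

(* Defs.v *)
From HB Require Import structures.
From mathcomp Require Import all_boot all_order all_algebra.
From mathcomp Require Import reals.

Set Implicit Arguments.
Unset Strict Implicit.
Unset Printing Implicit Defensive.

Import Order.TTheory GRing.Theory Num.Theory.

Section Clutters.

Variable E : finType.
Implicit Types (C D M : {set {set E}}) (A B H T X : {set E}).

Definition is_clutter C : Prop :=
  forall H H', H \in C -> H' \in C -> H \subset H' -> H = H'.

Definition minimal_members C : {set {set E}} :=
  [set X | minset (mem C) X].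

Definition transversals C : {set {set E}} :=
  [set T | minset (fun B => [forall H in C, B :&: H != set0]) T].

(* Every transversal has at most #|E| elements, so the default value #|E| is
   only reached as a default when there is no transversal, that is, when
   set0 \in C. *)
Definition bn C : nat := \big[minn/#|E|]_(T in transversals C) #|T|.

Definition minb C : {set {set E}} :=
  [set B in transversals C | #|B| == bn C].

Definition pn C : nat :=
  \max_(P : {set {set E}} | (P \subset C) && trivIset P) #|P|.

(* The clutter whose only hyperedge is set0 has no transversal: its blocking
   number is infinite. As usual its packing number is also infinite (the
   hyperedge set0 is disjoint from itself and may be repeated), so it packs.
   This matters because every nonempty clutter contracts to it. *)
Definition packs C : bool := (C == [set set0]) || (pn C == bn C).

Definition contraction C A : {set {set E}} :=
  minimal_members [set X :\: A | X in C].

Definition deletion C A : {set {set E}} :=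
  [set X in C | X :&: A == set0].

(* A minor is identified with its family of hyperedges, as subsets of E. *)
Inductive minor C : {set {set E}} -> Prop :=
| minor_refl : minor C C
| minor_contraction M A : minor C M -> minor C (contraction M A)
| minor_deletion M A : minor C M -> minor C (deletion M A).

Definition minimally_non_packing C : Prop :=
  ~~ packs C /\ forall M, minor C M -> M <> C -> packs M.

Definition tilde C : {set {set E}} :=
  [set H in C | [forall B in minb C, #|H :&: B| == 1]].

Definition combinatorial_affine_plane C : Prop :=
  [/\ is_clutter C,
      forall H H', H \in C -> H' \in C -> H != H' -> #|H :&: H'| = 1,
      forall (a : E) H, H \in C -> a \notin H ->
        exists! b : E,
          b \in H /\ ~ (exists K, [/\ K \in C, a \in K & b \in K])
    & exists H1 H2 H3,
        [/\ [/\ H1 \in C, H2 \in C & H3 \in C],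
            [/\ H1 != H2, H1 != H3 & H2 != H3]
          & H1 :&: H2 :&: H3 = set0]].

End Clutters.

Section Ideal.

Local Open Scope ring_scope.

Variables (R : realType) (E : finType).

Definition conv_hull (S : {ffun E -> R} -> Prop) (x : {ffun E -> R}) : Prop :=
  exists (n : nat) (p : 'I_n -> {ffun E -> R}) (w : 'I_n -> R),
    [/\ forall i, S (p i), forall i, 0 <= w i, \sum_i w i = 1
      & forall e, x e = \sum_i w i * p i e].

(* A polyhedron is integral if it is the convex hull of the integer points it
   contains. *)
Definition integral_polyhedron (Q : {ffun E -> R} -> Prop) : Prop :=
  forall x, Q x <->
    conv_hull (fun y => Q y /\ forall e, y e \is a Num.int) x.

Definition covering_polyhedron (C : {set {set E}}) (x : {ffun E -> R}) : Prop :=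
  (forall e, 0 <= x e) /\ (forall H, H \in C -> 1 <= \sum_(e in H) x e).

Definition ideal (C : {set {set E}}) : Prop :=
  integral_polyhedron (covering_polyhedron C).

End Ideal.

Arguments ideal R {E} C.

(* Main.v *)
(* Call two elements of E parallel if they are equal or in no common hyperedge
   of C, and put n = bn(D). The minimum transversals of D are exactly the
   parallel classes: deleting e must lower bn (otherwise D would pack), so every
   e is in one of them, and tilde(D) = C forces each of them to be a full
   parallel class. If there are m classes, then |H| = m for H in C, |H| > m for
   H in D \ C, and m <= n + 1.

   Idealness is used at one point only: for p in C the vector
   (1 + 1_p) / (m + 1) lies in the covering polyhedron of D and is tight on
   C \ {p} but not on p. Some integer point in a convex decomposition of it
   has the same property, which forces its support into p; hence every
   hyperedge of D meets every hyperedge of C.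

   For an element e, the clutter D \ e packs, which gives n - 1 >= 2 pairwise
   disjoint members of D avoiding e; by counting, one of them, H, has at most
   m + 1 elements. If |H| = m then H is in C, so it meets the other members, a
   contradiction. If |H| = m + 1 then H meets one class B0 in two elements
   a, a' and every other class once. Counting hyperedges of C through the other
   elements of B0 shows that any two elements of G = H \ B0 share a hyperedge
   of C with a or with a'. These are two equivalence relations on G covering all
   pairs, so one of them is total, and then H properly contains a hyperedge of
   C. *)

Require Import Defs.
From mathcomp Require Import all_boot all_order all_algebra.
From mathcomp Require Import reals.
From mathcomp Require Import zify lra.

Set Implicit Arguments.
Unset Strict Implicit.
Unset Printing Implicit Defensive.

Import Order.TTheory GRing.Theory Num.Theory.

(** * Double counting of incidences *)

Section DoubleCounting.

Variable E : finType.
Implicit Types (P : {set {set E}}) (A X : {set E}).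

Lemma sum_card_setI P A :
  \sum_(X in P) #|X :&: A| = \sum_(e in A) #|[set X in P | e \in X]|.
Proof.
under eq_bigr => X _.
  rewrite -sum1_card (eq_bigl (fun e => (e \in A) && (e \in X))) => [|e].
    rewrite big_mkcondr; over.
  by rewrite inE andbC.
rewrite exchange_big /=; apply: eq_bigr => e _.
by rewrite -big_mkcondr sum1dep_card.
Qed.

Lemma leq_sum_card_setI P A :
  (forall X Y e,
     X \in P -> Y \in P -> e \in A -> e \in X -> e \in Y -> X = Y) ->
  \sum_(X in P) #|X :&: A| <= #|A|.
Proof.
move=> disjP; rewrite sum_card_setI -[leqRHS]sum1_card; apply: leq_sum => e eA.
apply/card_le1_eqP => X Y; rewrite !inE => /andP[XP eX] /andP[YP eY].
exact: disjP eA _ _.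
Qed.

Lemma leq_card_disjoint_meet P A :
  (forall X, X \in P -> X :&: A != set0) ->
  (forall X Y e,
     X \in P -> Y \in P -> e \in A -> e \in X -> e \in Y -> X = Y) ->
  #|P| <= #|A|.
Proof.
move=> meetP /leq_sum_card_setI; apply: leq_trans; rewrite -sum1_card.
by apply: leq_sum => X /meetP; rewrite card_gt0.
Qed.

End DoubleCounting.

(** * Blocking and packing numbers *)

Section BlockingNumber.

Variable E : finType.
Implicit Types (C D P : {set {set E}}) (B H T : {set E}).

Definition covers D B := [forall H in D, B :&: H != set0].

Lemma bn_le_covers D B : covers D B -> bn D <= #|B|.
Proof.
move=> /minset_exists[T minT /subset_leq_card]; apply: leq_trans.
rewrite /bn -minEnat -leEnat; apply: (@bigmin_le_cond _ _ _ _ T).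
by rewrite inE.
Qed.

Lemma bn_attained D : set0 \notin D -> exists2 B, B \in minb D & #|B| = bn D.
Proof.
move=> D0; have covT : covers D setT.
  by apply/forall_inP=> H HD; rewrite setTI; apply: contraNneq D0 => <-.
have [T minT _] := minset_exists covT.
have TD : T \in transversals D by rewrite inE.
(* The default [#|E|] of the minimum is harmless: it bounds the size of every transversal, and [T]
   is one. *)
have [|B BD eB] := @eq_bigmin _ _ _ #|E| T
    (mem (transversals D)) (fun B => #|B|) TD.
  by move=> B _; apply: max_card.
have {}eB : bn D = #|B| by rewrite -eB /bn minEnat.
by exists B; rewrite // inE BD eB eqxx.
Qed.

Lemma covers_minb D B : covers D B -> #|B| <= bn D -> B \in minb D.
Proof.
move=> covB leB; have [T minT sTB] := minset_exists covB.
have /minsetP[covT _] := minT.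
have leT := bn_le_covers covT.
have /eqP eTB : T == B by rewrite eqEcard sTB (leq_trans leB).
by rewrite inE inE -eTB minT eqn_leq leT eTB leB.
Qed.

Lemma minb_covers D B : B \in minb D -> covers D B.
Proof. by rewrite !inE => /andP[/minsetP[]]. Qed.

Lemma minb_card D B : B \in minb D -> #|B| = bn D.
Proof. by rewrite !inE => /andP[_ /eqP]. Qed.

Lemma pn_attained D :
  exists P, [/\ P \subset D, trivIset P & #|P| = pn D].
Proof.
have [|P /andP[sPD tP] eP] := @eq_bigmax_cond _
    (fun P => (P \subset D) && trivIset P) (fun P => #|P|).
  apply/card_gt0P; exists set0; rewrite unfold_in sub0set.
  by apply/trivIsetP => X; rewrite inE.
by exists P; split.
Qed.

Lemma leq_pn D P : P \subset D -> trivIset P -> #|P| <= pn D.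
Proof.
move=> sPD tP; apply: (@leq_bigmax_cond _ _ (fun P => #|P|)).
by rewrite sPD.
Qed.

Lemma trivIset_mem_eq P H K e :
  trivIset P -> H \in P -> K \in P -> e \in H -> e \in K -> H = K.
Proof.
move=> /trivIsetP tP HP KP eH eK; apply/eqP/negPn/negP => /(tP _ _ HP KP).
by move/disjointFr=> /(_ _ eH); rewrite eK.
Qed.

Lemma pn_le_bn D : set0 \notin D -> pn D <= bn D.
Proof.
move=> /bn_attained[B Bmin <-]; have [P [/subsetP sPD tP <-]] := pn_attained D.
apply: leq_card_disjoint_meet => [H /sPD HD|H K e HP KP _].
  by rewrite setIC (forall_inP (minb_covers Bmin)).
exact: trivIset_mem_eq tP HP KP.
Qed.

End BlockingNumber.

(** * Deleting one element of a minimally non-packing clutter *)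

Section MinimallyNonPacking.

Variables (E : finType) (D : {set {set E}}).
Hypotheses (Dclutter : is_clutter D) (Dmnp : minimally_non_packing D).

(** A clutter containing [set0] is [[set set0]], which packs by convention. *)
Lemma mnp_set0 : set0 \notin D.
Proof.
have [nD _] := Dmnp; apply: contraNN nD => D0; apply/orP; left.
apply/eqP/setP => X; rewrite inE; apply/idP/eqP => [XD|-> //].
by rewrite (Dclutter D0 XD (sub0set _)).
Qed.

Lemma mnp_pn_lt_bn : pn D < bn D.
Proof.
have [nD _] := Dmnp; rewrite ltn_neqAle (pn_le_bn mnp_set0) andbT.
by apply: contraNN nD => eD; apply/orP; right.
Qed.

Variables (e : E) (H0 : {set E}).
Hypotheses (H0D : H0 \in D) (eH0 : e \in H0).

Lemma in_deletion1 H : (H \in deletion D [set e]) = (H \in D) && (e \notin H).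
Proof. by rewrite inE setI_eq0 disjoint_sym disjoints1. Qed.

(** The deletion loses [H0], so it is a proper minor and packs; without [set0] it cannot do so
    through the exceptional clause of [packs]. *)
Lemma mnp_deletion1 :
  set0 \notin deletion D [set e] /\
  pn (deletion D [set e]) = bn (deletion D [set e]).
Proof.
have d0 : set0 \notin deletion D [set e] by rewrite inE negb_and mnp_set0.
split=> //; have [_ /(_ (deletion D [set e]))] := Dmnp.
case/(_ _ _)/orP => [||/eqP e0|/eqP//].
- exact/minor_deletion/minor_refl.
- by move=> eD; move: H0D; rewrite -eD in_deletion1 eH0 andbF.
- by rewrite e0 inE eqxx in d0.
Qed.

Lemma mnp_deletion1_extend B :
  B \in minb (deletion D [set e]) -> covers D (e |: B).
Proof.
move=> /minb_covers covB; apply/forall_inP => H HD; apply/set0Pn.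
have [eH|neH] := boolP (e \in H); first by exists e; rewrite !inE eqxx eH.
have : B :&: H != set0 by rewrite (forall_inP covB) // in_deletion1 HD.
by case/set0Pn=> x /setIP[xB xH]; exists x; rewrite !inE xB xH orbT.
Qed.

Lemma pn_deletion1_le : pn (deletion D [set e]) <= pn D.
Proof.
have [P [sPD tP <-]] := pn_attained (deletion D [set e]).
by apply: leq_pn => //; apply: subset_trans sPD _; apply/subsetP=> H /setIdP[].
Qed.

(** Adding [e] to a minimum transversal of the deletion gives a cover of [D] with at most
    [pn D + 1 <= bn D] elements. *)
Lemma mnp_mem_minb : exists2 B, B \in minb D & e \in B.
Proof.
have [/bn_attained[B Bmin cardB] pn_bn] := mnp_deletion1.
exists (e |: B); last by rewrite setU11.
apply: covers_minb (mnp_deletion1_extend Bmin) _.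
rewrite (leq_trans _ mnp_pn_lt_bn) // cardsU1 cardB -pn_bn.
by rewrite -add1n leq_add ?pn_deletion1_le ?leq_b1.
Qed.

(** The packing number of the deletion is pinned from both sides: it is at most [pn D < bn D], and
    it equals the blocking number of the deletion, which is at least [bn D - 1]. *)
Lemma mnp_packing_avoiding :
  exists P : {set {set E}}, [/\ P \subset D, trivIset P, #|P| = (bn D).-1
                & forall H, H \in P -> e \notin H].
Proof.
have [/bn_attained[B Bmin cardB] pn_bn] := mnp_deletion1.
have [P [/subsetP sPD tP cardP]] := pn_attained (deletion D [set e]).
have le_bn : bn D <= #|B|.+1.
  apply: leq_trans (bn_le_covers (mnp_deletion1_extend Bmin)) _.
  by rewrite cardsU1 -add1n leq_add2r leq_b1.
have lt_bn := leq_ltn_trans pn_deletion1_le mnp_pn_lt_bn.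
exists P; split=> // [||H /sPD].
- by apply/subsetP=> H /sPD /setIdP[].
- lia.
- by rewrite in_deletion1 => /andP[].
Qed.

End MinimallyNonPacking.

(** * Incidence geometry of a combinatorial affine plane *)

Section AffinePlane.

Variables (E : finType) (C : {set {set E}}).
Hypothesis plane : combinatorial_affine_plane C.
Implicit Types (H K : {set E}) (a b x y : E).

Definition joined a b := [exists K in C, (a \in K) && (b \in K)].

Lemma joinedP a b :
  reflect (exists K, [/\ K \in C, a \in K & b \in K]) (joined a b).
Proof.
apply: (iffP exists_inP) => [[K KC /andP[]]|[K [KC aK bK]]]; exists K => //.
by rewrite aK.
Qed.

Lemma hyperedge_meet H K x y :
  H \in C -> K \in C -> H != K ->
  x \in H -> x \in K -> y \in H -> y \in K -> x = y.
Proof.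
case: plane => _ meet1 _ _ HC KC neHK xH xK yH yK.
have /eqP/cards1P[z eHK] := meet1 _ _ HC KC neHK.
have : x \in H :&: K by rewrite inE xH.
have : y \in H :&: K by rewrite inE yH.
by rewrite eHK !inE => /eqP-> /eqP->.
Qed.

Lemma hyperedge_eq H K x y :
  H \in C -> K \in C -> x != y ->
  x \in H -> x \in K -> y \in H -> y \in K -> H = K.
Proof.
move=> HC KC nexy xH xK yH yK; apply: contraNeq nexy => neHK.
exact/eqP/(hyperedge_meet HC KC neHK).
Qed.

Lemma hyperedges_meet H K :
  H \in C -> K \in C -> H != K -> exists2 x, x \in H & x \in K.
Proof.
case: plane => _ meet1 _ _ HC KC neHK.
have /eqP/cards1P[x eHK] := meet1 _ _ HC KC neHK.
by exists x; have : x \in H :&: K by [rewrite eHK inE]; rewrite inE => /andP[].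
Qed.

Lemma parallel_exists a H :
  H \in C -> a \notin H -> exists2 b, b \in H & ~~ joined a b.
Proof.
case: plane => _ _ par _ HC aH; have [b [[bH nab] _]] := par a H HC aH.
by exists b => //; apply/joinedP.
Qed.

Lemma parallel_unique a H x y :
  H \in C -> a \notin H -> x \in H -> y \in H ->
  ~~ joined a x -> ~~ joined a y -> x = y.
Proof.
case: plane => _ _ par _ HC aH xH yH /joinedP nax /joinedP nay.
have [b [_ bU]] := par a H HC aH.
by rewrite -(bU x) // -(bU y).
Qed.

(** The three given hyperedges form a triangle [a], [b], [c]. The element [d] of [H1] parallel to
    the opposite vertex [c] differs from [a] and [b], which are joined to [c] by [H2] and [H3]. *)
Lemma exists_hyperedge_card_ge3 : exists2 H, H \in C & 2 < #|H|.
Proof.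
case: (plane) => _ _ _ [H1 [H2 [H3 [[H1C H2C H3C] [ne12 ne13 ne23] I0]]]].
have [a a1 a2] := hyperedges_meet H1C H2C ne12.
have [b b1 b3] := hyperedges_meet H1C H3C ne13.
have [c c2 c3] := hyperedges_meet H2C H3C ne23.
have I x : x \in H1 -> x \in H2 -> x \in H3 -> False.
  move=> x1 x2 x3; have : x \in H1 :&: H2 :&: H3 by rewrite !inE x1 x2.
  by rewrite I0 inE.
have c1 : c \notin H1 by apply/negP => c1; apply: (I c).
have [d d1 /joinedP ncd] := parallel_exists H1C c1.
exists H1 => //; have -> : 3 = #|[set a; b; d]|.
  have neab : a != b by apply/eqP => eab; apply: (I a); rewrite // eab.
  have nead : a != d by apply/eqP => ead; apply: ncd; exists H2; rewrite -ead.
  have nebd : b != d by apply/eqP => ebd; apply: ncd; exists H3; rewrite -ebd.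
  by rewrite setUC cardsU1 cards2 !inE !(eq_sym d) negb_or neab nead nebd.
apply: subset_leq_card; apply/subsetP=> x; rewrite !inE.
by case/orP=> [/orP[]|] /eqP->.
Qed.

(** An element in no hyperedge would be unjoined to two elements of [H], against uniqueness of the
    parallel. *)
Lemma hyperedge_through a : exists2 K, K \in C & a \in K.
Proof.
have [H HC /ltnW/card_gt1P[x [y [xH yH nexy]]]] := exists_hyperedge_card_ge3.
have [aH|aH] := boolP (a \in H); first by exists H.
have [/joinedP[K [KC aK _]]|nax] := boolP (joined a x); first by exists K.
have [/joinedP[K [KC aK _]]|nay] := boolP (joined a y); first by exists K.
by rewrite (parallel_unique HC aH xH yH nax nay) eqxx in nexy.
Qed.

(** Joining [a] to the elements of [H] other than its parallel [b] gives distinct hyperedges: one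
    containing two elements of [H] would be [H], which avoids [a]. *)
Lemma degree_ge a H :
  H \in C -> a \notin H -> #|H|.-1 <= #|[set K in C | a \in K]|.
Proof.
move=> HC aH; have [b bH nab] := parallel_exists HC aH.
pose f x := odflt set0 [pick K | [&& K \in C, a \in K & x \in K]].
have fP x : x \in H :\ b -> [/\ f x \in C, a \in f x & x \in f x].
  rewrite !inE /f => /andP[nexb xH]; case: pickP => [K /and3P[]//|noK] /=.
  have nax : ~~ joined a x.
    by apply/joinedP => -[K [KC aK xK]]; have:= noK K; rewrite KC aK xK.
  by rewrite (parallel_unique HC aH xH bH nax nab) eqxx in nexb.
have finj : {in H :\ b &, injective f}.
  move=> x y xHb yHb; have [fxC afx xfx] := fP x xHb.
  have [_ _] := fP y yHb; move=> + efxy; rewrite -efxy => yfx.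
  move: xHb yHb; rewrite !inE => /andP[_ xH] /andP[_ yH].
  apply: (hyperedge_meet HC fxC) => //.
  by apply: contraNneq aH => ->.
rewrite (cardsD1 b H) bH /= -(card_in_imset finj); apply: subset_leq_card.
by apply/subsetP => _ /imsetP[x /fP[fxC afx _] ->]; rewrite inE fxC.
Qed.

End AffinePlane.

(** * Minimum transversals as parallel classes *)

Section MinimumTransversals.

Variables (E : finType) (D : {set {set E}}).
Hypothesis plane : combinatorial_affine_plane (tilde D).
Hypothesis minbT : forall e, exists2 B, B \in minb D & e \in B.
Implicit Types (B H K X : {set E}) (a b x y : E).

Let C := tilde D.

Lemma tilde_meet H B : H \in C -> B \in minb D -> #|H :&: B| = 1.
Proof. by case/setIdP=> _ /forall_inP meet1 /meet1/eqP. Qed.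

Lemma tilde_meet_ex H B :
  H \in C -> B \in minb D -> exists2 x, x \in H & x \in B.
Proof.
move=> HC BD; have /eqP/cards1P[x eHB] := tilde_meet HC BD.
by exists x; have : x \in H :&: B by [rewrite eHB inE]; rewrite inE => /andP[].
Qed.

Lemma tilde_meet_eq H B x y :
  H \in C -> B \in minb D ->
  x \in H -> x \in B -> y \in H -> y \in B -> x = y.
Proof.
move=> HC BD xH xB yH yB; have /eqP/cards1P[z eHB] := tilde_meet HC BD.
have : x \in H :&: B by rewrite inE xH.
have : y \in H :&: B by rewrite inE yH.
by rewrite eHB !inE => /eqP-> /eqP->.
Qed.

Lemma minb_parallel B x y :
  B \in minb D -> x \in B -> y \in B -> x != y -> ~~ joined C x y.
Proof.
move=> BD xB yB; apply: contraNN => /joinedP[K [KC xK yK]].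
exact/eqP/(tilde_meet_eq KC BD).
Qed.

(** A hyperedge [K] through [y] meets [B] in some [z], unjoined to [x] since both lie in [B];
    uniqueness of the parallel on [K] gives [y = z]. *)
Lemma parallel_mem_minb B x y :
  B \in minb D -> x \in B -> ~~ joined C x y -> y \in B.
Proof.
move=> BD xB nxy; have [K KC yK] := hyperedge_through plane y.
have xK : x \notin K.
  by apply: contraNN nxy => xK; apply/joinedP; exists K.
have [z zK zB] := tilde_meet_ex KC BD.
rewrite (parallel_unique plane KC xK yK zK nxy) //.
by apply: (minb_parallel BD) => //; apply: contraNneq xK => ->.
Qed.

Lemma minb_eq B B' e :
  B \in minb D -> B' \in minb D -> e \in B -> e \in B' -> B = B'.
Proof.
have sub A A' : A \in minb D -> A' \in minb D -> e \in A -> e \in A' ->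
    A \subset A'.
  move=> AD AD' eA eA'; apply/subsetP => x xA.
  have [<- //|neex] := eqVneq e x.
  exact: parallel_mem_minb AD' eA' (minb_parallel AD eA xA neex).
move=> BD BD' eB eB'; apply/eqP; rewrite eqEsubset.
by rewrite (sub B B') // (sub B' B).
Qed.

Lemma minb_joined B x y :
  B \in minb D -> x \in B -> y \notin B -> joined C x y.
Proof. by move=> BD xB; apply: contraNT; apply: parallel_mem_minb. Qed.

(** The minimum transversals partition [E]. *)
Lemma sum_card_minb X : \sum_(B in minb D) #|X :&: B| = #|X|.
Proof.
under eq_bigr => B _ do rewrite setIC.
rewrite sum_card_setI -[RHS]sum1_card; apply: eq_bigr => e _.
have [B BD eB] := minbT e; apply/eqP/cards1P; exists B; apply/setP => B'.
apply/setIdP/set1P => [[BD' eB']|-> //].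
exact: minb_eq BD' BD eB' eB.
Qed.

Lemma card_tilde H : H \in C -> #|H| = #|minb D|.
Proof.
move=> HC; rewrite -sum_card_minb -sum1_card; apply: eq_bigr => B BD.
exact: tilde_meet.
Qed.

Lemma meet_minb_gt0 H B : H \in D -> B \in minb D -> 0 < #|H :&: B|.
Proof.
by move=> HD /minb_covers/forall_inP covB; rewrite card_gt0 setIC covB.
Qed.

Lemma card_not_tilde H : H \in D -> H \notin C -> #|minb D| < #|H|.
Proof.
move=> HD; rewrite inE HD /= => /forall_inPn[B BD neB].
rewrite -[#|H|]sum_card_minb -sum1_card (bigD1 B) //= [ltnRHS](bigD1 B) //=.
rewrite -addSn leq_add //; first by rewrite ltn_neqAle eq_sym neB meet_minb_gt0.
by apply: leq_sum => B' /andP[BD' _]; apply: meet_minb_gt0.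
Qed.

Lemma card_ge_minb H : H \in D -> #|minb D| <= #|H|.
Proof.
move=> HD; have [/card_tilde-> //|HC] := boolP (H \in C).
exact/ltnW/card_not_tilde.
Qed.

Lemma card_minb_ge3 : 2 < #|minb D|.
Proof.
by have [H /card_tilde <-] := exists_hyperedge_card_ge3 plane.
Qed.

Lemma exists_hyperedge_avoiding a : exists2 H, H \in C & a \notin H.
Proof.
have := plane; case=> _ _ _ [H1 [H2 [H3 [[H1C H2C H3C] _ I0]]]].
have [a1|] := boolP (a \in H1); last by exists H1.
have [a2|] := boolP (a \in H2); last by exists H2.
have [a3|] := boolP (a \in H3); last by exists H3.
have : a \in H1 :&: H2 :&: H3 by rewrite !inE a1 a2.
by rewrite I0 inE.
Qed.

Lemma degree_ge_minb a : #|minb D|.-1 <= #|[set K in C | a \in K]|.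
Proof.
have [H HC aH] := exists_hyperedge_avoiding a.
by rewrite -(card_tilde HC); apply: degree_ge.
Qed.

(** At least [m - 1] hyperedges pass through an element [a] outside [B2]; they meet [B2] in distinct
    elements. *)
Lemma card_minb_le : #|minb D| <= (bn D).+1.
Proof.
have [B1 [B2 [B1D B2D ne12]]] := card_gt1P (ltnW card_minb_ge3).
have [a aB1] : exists a, a \in B1.
  have [H HC _] := exists_hyperedge_card_ge3 plane.
  by have [a _ aB1] := tilde_meet_ex HC B1D; exists a.
have aB2 : a \notin B2.
  by apply: contraNN ne12 => aB2; apply/eqP/(minb_eq B1D B2D aB1).
rewrite -(minb_card B2D) -[X in X <= _]prednK ?(ltnW (ltnW card_minb_ge3)) //.
rewrite ltnS (leq_trans (degree_ge_minb a)) //.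
apply: leq_card_disjoint_meet => [K /setIdP[KC _]|K K' e].
  by rewrite -card_gt0 tilde_meet.
move=> /setIdP[KC aK] /setIdP[KC' aK'] eB2 eK eK'.
apply: (hyperedge_eq plane KC KC' _ aK aK' eK eK').
by apply: contraNneq aB2 => ->.
Qed.

End MinimumTransversals.

(** * Tight and slack values in convex combinations *)

Section ConvexCombination.

Local Open Scope ring_scope.

Variables (R : realType) (n : nat) (w : 'I_n -> R).
Hypotheses (w_ge0 : forall i, 0 <= w i) (sum_w : \sum_i w i = 1).

Lemma convex_comb_eq1 (v : 'I_n -> R) i :
  (forall j, 1 <= v j) -> \sum_j w j * v j = 1 -> 0 < w i -> v i = 1.
Proof.
move=> v_ge1 sum_wv wi; have sum0 : \sum_j w j * (v j - 1) = 0.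
  under eq_bigr => j _ do rewrite mulrBr mulr1.
  by rewrite sumrB sum_wv sum_w subrr.
have := psumr_eq0P (P := xpredT) _ sum0 => /(_ _ i isT) /eqP.
rewrite mulf_eq0 gt_eqF //= subr_eq0 => h; apply/eqP/h => j _.
by rewrite mulr_ge0 ?subr_ge0.
Qed.

Lemma convex_comb_gt1 (v : 'I_n -> R) :
  1 < \sum_j w j * v j -> exists i, 0 < w i /\ 1 < v i.
Proof.
move=> gt1; have [/existsP[i /andP[wi vi]]|] :=
  boolP [exists i, (0 < w i) && (1 < v i)]; first by exists i.
move=> /existsPn noi; move: gt1; rewrite ltNge -sum_w => /negP[].
apply: ler_sum => i _; have := noi i; rewrite negb_and -!leNgt.
case/orP=> [wi|vi]; last by rewrite ler_piMr.
suff -> : w i = 0 by rewrite mul0r.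
by apply/eqP; rewrite eq_le wi w_ge0.
Qed.

End ConvexCombination.

(** * Idealness makes hyperedges of the plane covers *)

Section IdealCover.

Local Open Scope ring_scope.

Variables (R : realType) (E : finType) (D : {set {set E}}).
Hypothesis plane : combinatorial_affine_plane (tilde D).
Hypothesis minbT : forall e, exists2 B, B \in minb D & e \in B.
Hypothesis idealD : ideal R D.
Implicit Types (H K p : {set E}) (a e f : E).

Let C := tilde D.
Let m := #|minb D|.

Lemma le_sum2 (y : {ffun E -> R}) H a b :
  (forall e, 0 <= y e) -> a \in H -> b \in H -> a != b ->
  y a + y b <= \sum_(e in H) y e.
Proof.
move=> y0 aH bH neab; rewrite (bigD1 a) //= lerD2l (bigD1 b) /=; last first.
  by rewrite bH eq_sym.
by rewrite lerDl sumr_ge0.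
Qed.

(** Suppose [y a] is nonzero. If [e] in [p] is joined to [a] and [y e] is nonzero, their common
    hyperedge has weight at least 2, yet it is not [p]. So all weight of [p] sits on the parallel
    [b] of [a], and [y b > 1] breaks tightness on another hyperedge through [b]. *)
Lemma integral_cover_support (y : {ffun E -> R}) p a :
  p \in C -> (forall e, 0 <= y e) -> (forall e, y e \is a Num.int) ->
  (forall H, H \in C -> H != p -> \sum_(e in H) y e = 1) ->
  1 < \sum_(e in p) y e -> a \notin p -> y a = 0.
Proof.
move=> pC y0 yint yH yp ap; apply/eqP/negPn/negP => ya0.
have ge1 e : y e != 0 -> 1 <= y e.
  by move=> ye; rewrite -(ger0_norm (y0 e)); apply: norm_intr_ge1.
have noK e : e \in p -> y e != 0 -> ~~ joined C a e.
  move=> ep ye; apply/joinedP => -[K [KC aK eK]].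
  have neKp : K != p by apply: contraNneq ap => <-.
  have neae : a != e by apply: contraNneq ap => ->.
  have := le_sum2 y0 aK eK neae; rewrite yH //.
  by have := ge1 _ ya0; have := ge1 _ ye; lra.
have [b bp nab] := parallel_exists plane pC ap.
have supp e : e \in p -> e != b -> y e = 0.
  move=> ep neeb; apply/eqP; apply: contraNT neeb => ye.
  exact/eqP/(parallel_unique plane pC ap ep bp (noK _ ep ye) nab).
have yb : 1 < y b.
  move: yp; rewrite (bigD1 b) //= big1 ?addr0 // => e /andP[].
  exact: supp.
have [K KC /andP[bK neKp]] : exists2 K, K \in C & (b \in K) && (K != p).
  have : (1 < #|[set K in C | b \in K]|)%N.
    apply: leq_trans (degree_ge_minb plane minbT b).
    have m_gt2 := card_minb_ge3 plane minbT.
    by rewrite -ltnS prednK // (ltn_trans _ m_gt2).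
  case/card_gt1P=> K [K' [/setIdP[KC bK] /setIdP[KC' bK'] neKK']].
  have [eKp|neKp] := eqVneq K p; last by exists K; rewrite // bK.
  by exists K'; rewrite // bK' -eKp eq_sym.
have := yH K KC neKp; rewrite (bigD1 b) //= => eK.
have : 0 <= \sum_(i in K | i != b) y i by rewrite sumr_ge0.
lra.
Qed.

Lemma tilde_covers p : p \in C -> covers D p.
Proof.
move=> pC; have m_gt2 : (2 < m)%N := card_minb_ge3 plane minbT.
have m1_gt0 : 0 < m%:R + 1 :> R by rewrite ltr_wpDl.
pose x : {ffun E -> R} := [ffun e => (1 + (e \in p)%:R) / (m%:R + 1)].
(* The numerator is [m + 1] on hyperedges of [C] other than [p], [2m] on [p], and at least [m + 1]
   on members of [D] outside [C]. *)
have sum_x H : \sum_(e in H) x e = (#|H| + #|H :&: p|)%:R / (m%:R + 1).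
  under eq_bigr => e _ do rewrite ffunE.
  rewrite -mulr_suml big_split /= sumr_const -natr_sum natrD.
  congr ((_ + _%:R) / _); rewrite -sum1_card big_mkcond [RHS]big_mkcond /=.
  by apply: eq_bigr => e _; rewrite inE; case: (e \in H); case: (e \in p).
have xD : covering_polyhedron D x.
  split=> [e|H HD]; first by rewrite ffunE divr_ge0 ?addr_ge0.
  rewrite sum_x ler_pdivlMr // mul1r natr1 ler_nat.
  have [HC|HC] := boolP (H \in C); last first.
    by rewrite (leq_trans (card_not_tilde plane minbT HD HC)) ?leq_addr.
  rewrite (card_tilde plane minbT HC) -addn1 leq_add2l card_gt0.
  apply/set0Pn; have [->|neHp] := eqVneq H p.
    have [e ep] : exists e, e \in p.
      apply/set0Pn; rewrite -card_gt0 (card_tilde plane minbT pC).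
      exact: ltn_trans m_gt2.
    by exists e; rewrite inE ep.
  have [e eH ep] := hyperedges_meet plane HC pC neHp.
  by exists e; rewrite inE eH.
have [/(_ xD)[k [y [w [yQ w0 sum_w xE]]]] _] := idealD x.
have sum_xE H : \sum_(e in H) x e = \sum_i w i * \sum_(e in H) y i e.
  under eq_bigr => e _ do rewrite xE.
  by rewrite exchange_big; apply: eq_bigr => i _; rewrite mulr_sumr.
have x_eq1 H : H \in C -> H != p -> \sum_(e in H) x e = 1.
  move=> HC neHp; rewrite sum_x (card_tilde plane minbT HC).
  case: (plane) => _ meet1 _ _; rewrite meet1 // natrD divff // gt_eqF //.
have x_gt1 : 1 < \sum_(e in p) x e.
  rewrite sum_x setIid (card_tilde plane minbT pC) ltr_pdivlMr // mul1r.
  by rewrite natr1 ltr_nat -addn1 ltn_add2l (ltn_trans _ m_gt2).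
have [i [wi yi_gt1]] : exists i, 0 < w i /\ 1 < \sum_(e in p) y i e.
  by apply: convex_comb_gt1 => //; rewrite -sum_xE.
have [[yi0 yiD] yi_int] := yQ i.
have yi_eq1 H : H \in C -> H != p -> \sum_(e in H) y i e = 1.
  move=> HC neHp; have HD : H \in D by case/setIdP: HC.
  apply: (convex_comb_eq1 w0 sum_w (v := fun j => \sum_(e in H) y j e)) => //.
    by move=> j; have [[_ yjD] _] := yQ j; apply: yjD.
  by rewrite -sum_xE x_eq1.
(* If [K] missed [p], then [y i] would vanish on [K] and violate its covering constraint. *)
apply/forall_inP => K KD; apply: contraTneq (yiD K KD) => pK0.
rewrite -ltNge big1 ?ltr01 // => e eK.
apply: (integral_cover_support pC yi0 yi_int yi_eq1 yi_gt1).
by apply: contraTN eK => ep; apply/negP => eK; have : e \in p :&: K;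
  [rewrite inE ep | rewrite pK0 inE].
Qed.

End IdealCover.

(** If [r1 x y] fails, [x] is [r2]-related to every [z]: when [r1 x z] holds, [r1 z y] fails, so
    [r2] links [z] to [x] through [y]. Midpoints are restricted to [G] because sharing a hyperedge
    with a fixed [z] need not be transitive at midpoint [z]. *)
Lemma union_equivalences_total (E : finType) (G : {set E}) (r1 r2 : rel E) :
  symmetric r1 -> symmetric r2 ->
  (forall x y z, y \in G -> r1 x y -> r1 y z -> r1 x z) ->
  (forall x y z, y \in G -> r2 x y -> r2 y z -> r2 x z) ->
  {in G &, forall x y, r1 x y || r2 x y} ->
  {in G &, forall x y, r1 x y} \/ {in G &, forall x y, r2 x y}.
Proof.
move=> sym1 sym2 trans1 trans2 tot.
have [/forall_inP all1|] := boolP [forall x in G, forall y in G, r1 x y].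
  by left=> x y /all1/forall_inP; apply.
case/forall_inPn=> x xG /forall_inPn[y yG nxy]; right.
have r2xy : r2 x y by have := tot x y xG yG; rewrite (negPf nxy).
suff hub z : z \in G -> r2 x z.
  by move=> z z' zG z'G; apply: trans2 xG _ (hub _ z'G); rewrite sym2 hub.
move=> zG; have /orP[r1xz|//] := tot x z xG zG.
have /orP[r1zy|] := tot z y zG yG; first by rewrite (trans1 x z y) in nxy.
by rewrite sym2; apply: trans2 yG r2xy.
Qed.

(** * Members of size [m + 1] *)

Section NearMinimalMember.

Variables (E : finType) (D : {set {set E}}).
Hypothesis Dclutter : is_clutter D.
Hypothesis plane : combinatorial_affine_plane (tilde D).
Hypothesis minbT : forall e, exists2 B, B \in minb D & e \in B.
Hypothesis tildeD_covers : forall p, p \in tilde D -> covers D p.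
Implicit Types (B G H K p : {set E}) (a c e g : E).

Let C := tilde D.
Let m := #|minb D|.

Lemma tilde_sub H : H \in C -> H \in D.
Proof. by case/setIdP. Qed.

(** All hyperedges joining [z] to elements of [G] coincide; the common one has [m] elements, hence
    is [z |: G], and lies in [H]. The clutter property then makes it equal to [H]. *)
Lemma concurrent_card G H z :
  H \in D -> G \subset H -> z \in H -> z \notin G -> #|G|.+1 = m ->
  (forall g, g \in G -> joined C z g) ->
  {in G &, forall g g', exists K, [/\ K \in C, z \in K, g \in K & g' \in K]} ->
  #|H| = m.
Proof.
move=> HD sGH zH zG cardG zGj conc.
have m_gt2 : 2 < m := card_minb_ge3 plane minbT.
have /card_gt0P[g0 g0G] : 0 < #|G| by lia.
have [K [KC zK g0K]] := joinedP _ _ _ (zGj g0 g0G).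
have sGK : G \subset K.
  apply/subsetP=> g gG; have [K' [K'C zK' g0K' gK']] := conc g0 g g0G gG.
  rewrite (hyperedge_eq plane KC K'C _ zK zK' g0K g0K') //.
  by apply: contraNneq zG => ->.
have cardK : #|K| = m := card_tilde plane minbT KC.
have /eqP eK : z |: G == K.
  by rewrite eqEcard subUset sub1set zK sGK cardsU1 zG cardK add1n cardG leqnn.
rewrite -cardK; congr #|pred_of_set _|; apply/esym/Dclutter => //.
  exact: tilde_sub.
by rewrite -eK subUset sub1set zH.
Qed.

Lemma card_member_neq H : 2 < bn D -> H \in D -> #|H| <> m.+1.
Proof.
move=> bn_gt2 HD cardH; have m_gt2 : 2 < m := card_minb_ge3 plane minbT.
have HC : H \notin C.
  apply/negP => /(card_tilde plane minbT) eH.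
  by apply: (@n_Sn m); rewrite -cardH.
have [B0 B0D neB0] : exists2 B0, B0 \in minb D & #|H :&: B0| != 1.
  by move: HC; rewrite inE HD /= => /forall_inPn.
have gt1 : 1 < #|H :&: B0|.
  by rewrite ltn_neqAle eq_sym neB0 (meet_minb_gt0 HD B0D).
have sum_ge (Q : pred {set E}) :
    #|[set B in minb D | Q B]| <= \sum_(B in minb D | Q B) #|H :&: B|.
  rewrite -sum1dep_card; apply: leq_sum => B /andP[BD _].
  exact: meet_minb_gt0 BD.
(* The [m] positive terms [#|H :&: B|] sum to [m + 1], so the single excess is at [B0]. *)
have cardHB0 : #|H :&: B0| = 2.
  have := sum_card_minb plane minbT H.
  rewrite (bigD1 B0) //= cardH.
  have := sum_ge (predC1 B0); have := cardsD1 B0 (minb D); rewrite B0D.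
  have -> : minb D :\ B0 = [set B in minb D | predC1 B0 B].
    by apply/setP=> B; rewrite !inE andbC.
  rewrite -/m /=; lia.
have meet1 B : B \in minb D -> B != B0 -> #|H :&: B| = 1.
  move=> BD neB; have := sum_card_minb plane minbT H.
  rewrite (bigD1 B0) //= (bigD1 B) /=; last by rewrite BD.
  have := meet_minb_gt0 HD BD; rewrite cardH cardHB0.
  have := sum_ge (fun A => (A != B0) && (A != B)).
  under eq_bigl do rewrite andbA.
  have := cardsD1 B0 (minb D); rewrite B0D.
  have := cardsD1 B (minb D :\ B0); rewrite !in_setD1 neB BD.
  have -> : minb D :\ B0 :\ B = [set A in minb D | (A != B0) && (A != B)].
    by apply/setP=> A; rewrite !inE; case: (A == B); case: (A == B0);
      rewrite /= ?andbT ?andbF.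
  rewrite -/m /=; set k := #|[set _ in _ | _]|; set s := \sum_(i | _) _.
  set d := #|minb D :\ B0|; set h := #|H :&: B|; lia.
pose G := H :\: B0.
have cardG : #|G|.+1 = m by have := cardsID B0 H; rewrite -/G; lia.
have GP g : g \in G -> g \in H /\ g \notin B0 by case/setDP.
have Gjoined g g' : g \in G -> g' \in G -> g != g' -> joined C g g'.
  move=> gG g'G negg'; have [B BD gB] := minbT g.
  apply: (minb_joined plane BD gB); apply: contraNN negg' => g'B.
  have /eqP/cards1P[z eHB] : #|H :&: B| = 1.
    by apply: meet1 => //; apply: contraNneq (GP g gG).2 => <-.
  have : g \in H :&: B by rewrite inE (GP g gG).1.
  have : g' \in H :&: B by rewrite inE (GP g' g'G).1.
  by rewrite eHB !inE => /eqP-> /eqP->.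
(* There are at least [m - 1 = #|G|] hyperedges of [C] through [c]; they are
   disjoint outside [c] and each of them has to meet [G]. *)
have Gmeet c K g g' : c \in B0 -> c \notin H -> K \in C -> c \in K ->
    g \in G -> g' \in G -> g \in K -> g' \in K -> g = g'.
  move=> cB0 cH KC cK gG g'G gK g'K; apply/eqP/negPn/negP => negg'.
  pose S := [set X in C | c \in X].
  have KS : K \in S by rewrite inE KC.
  have : \sum_(X in S) #|X :&: G| <= #|G|.
    apply: leq_sum_card_setI => X Y e /setIdP[XC cX] /setIdP[YC cY] eG eX eY.
    apply: (hyperedge_eq plane XC YC _ cX cY eX eY).
    by apply: contraNneq cH => ->; case: (GP e eG).
  rewrite (bigD1 K) //=.
  have : 1 < #|K :&: G|.
    by apply/card_gt1P; exists g, g'; rewrite !(in_setI, gK, g'K, gG, g'G).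
  have : \sum_(X in S | X != K) 1 <= \sum_(X in S | X != K) #|X :&: G|.
    apply: leq_sum => X /andP[/setIdP[XC cX] _]; apply/card_gt0P.
    (* The cover [X] meets [H], and not in [B0]: its only element there is [c], which is outside
       [H]. *)
    have /set0Pn[x /setIP[xX xH]] := forall_inP (tildeD_covers XC) H HD.
    exists x; rewrite inE xX !inE xH andbT; apply: contraNN cH => xB0.
    by rewrite (tilde_meet_eq XC B0D cX cB0 xX xB0).
  (* [K] contributes at least 2 and at least [m - 2] other hyperedges contribute 1 each, so the sum
     is at least [m = #|G| + 1]. *)
  have := degree_ge_minb plane minbT c.
  rewrite -/m -/C -/S -sum1_card (bigD1 K) //= -cardG.
  set u := \sum_(X in S | X != K) 1; set v := \sum_(X in S | _) _.
  by move: u v #|K :&: G| #|G|; clear; lia.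
have /cards2P[a [a' [neaa' eHB0]]] : #|H :&: B0| == 2 by apply/eqP.
have [aH aB0] : a \in H /\ a \in B0.
  by apply/setIP; rewrite eHB0 !inE eqxx.
have [a'H a'B0] : a' \in H /\ a' \in B0.
  by apply/setIP; rewrite eHB0 !inE eqxx orbT.
pose r z g g' := [exists K in C, [&& z \in K, g \in K & g' \in K]].
have rP z g g' : reflect (exists K, [/\ K \in C, z \in K, g \in K & g' \in K])
    (r z g g').
  by apply: (iffP exists_inP) => [[K KC /and3P[]]|[K [KC zK gK g'K]]];
    exists K => //; apply/and3P.
have zG z : z \in B0 -> z \notin G by rewrite inE => ->.
have zGj z : z \in B0 -> forall g, g \in G -> joined C z g.
  by move=> zB0 g /GP[_]; apply: (minb_joined plane B0D zB0).
have r_sym z : symmetric (r z).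
  by move=> g g'; apply/rP/rP => -[K []]; exists K.
have r_trans z : z \in B0 -> forall g1 g2 g3, g2 \in G ->
    r z g1 g2 -> r z g2 g3 -> r z g1 g3.
  move=> zB0 g1 g2 g3 g2G /rP[K [KC zK g1K g2K]] /rP[K' [K'C zK' g2K' g3K']].
  apply/rP; exists K; split=> //.
  rewrite (hyperedge_eq plane KC K'C _ zK zK' g2K g2K') //.
  by apply: contraNneq (zG z zB0) => ->.
have r_tot : {in G &, forall g g', r a g g' || r a' g g'}.
  move=> g g' gG g'G; have [<-|negg'] := eqVneq g g'.
    have /joinedP[K [KC aK gK]] := zGj a aB0 g gG.
    by apply/orP; left; apply/rP; exists K.
  have /joinedP[K [KC gK g'K]] := Gjoined g g' gG g'G negg'.
  have [z zK zB0] := tilde_meet_ex KC B0D.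
  (* By [Gmeet], the element of [K] in [B0] must belong to [H], so it is [a] or [a']. *)
  have zH : z \in H.
    apply: contraNT negg' => zH; apply/eqP.
    exact: Gmeet zB0 zH KC zK gG g'G gK g'K.
  have : z \in H :&: B0 by rewrite inE zH.
  rewrite eHB0 !inE => /orP[] /eqP ez; apply/orP; [left|right];
    by apply/rP; exists K; rewrite -ez.
have sGH : G \subset H by apply: subsetDl.
have [z [zH zB0 conc]] :
    exists z, [/\ z \in H, z \in B0 & {in G &, forall g g', r z g g'}].
  have [] := union_equivalences_total (r_sym a) (r_sym a') (r_trans a aB0)
    (r_trans a' a'B0) r_tot; [by exists a | by exists a'].
have : #|H| = m.
  apply: (concurrent_card HD sGH zH (zG z zB0) cardG (zGj z zB0)).
  by move=> g g' gG g'G; apply/rP/conc.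
by rewrite cardH => /esym/n_Sn.
Qed.

End NearMinimalMember.

(** * Contradiction from a packing that avoids one element *)

Theorem theorem5p10 (R : realType) (E : finType) (C : {set {set E}}) :
  combinatorial_affine_plane C ->
  3 <= bn C ->
  ~ (exists D : {set {set E}},
       [/\ is_clutter D, ideal R D, minimally_non_packing D & tilde D = C]).
Proof.
move=> plane bnC [D [Dclutter idealD Dmnp eC]]; move: plane bnC; rewrite -{}eC.
move=> plane bnC; have D0 := mnp_set0 Dclutter Dmnp.
have minbT e : exists2 B, B \in minb D & e \in B.
  have [H0 /tilde_sub H0D eH0] := hyperedge_through plane e.
  exact: (mnp_mem_minb Dclutter Dmnp H0D eH0).
have bn_gt2 : 2 < bn D.
  have [B BD <-] := bn_attained D0; apply: leq_trans bnC _; apply: bn_le_covers.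
  apply/forall_inP=> H /tilde_sub HD.
  exact: forall_inP (minb_covers BD) H HD.
have covC p := tilde_covers plane minbT idealD (p := p).
have [H1 H1C H1_gt2] := exists_hyperedge_card_ge3 plane.
have /card_gt0P[e eH1] : 0 < #|H1| by lia.
have [P [/subsetP sPD tP cardP eP]] :=
  mnp_packing_avoiding Dclutter Dmnp (tilde_sub H1C) eH1.
(* With [n = bn D], members all of size at least [m + 2] would give [(n - 1)(m + 2) <= mn - 1],
   hence [2n <= m + 1 <= n + 2], against [n > 2]. *)
have [H HP leH] : exists2 H, H \in P & #|H| <= #|minb D|.+1.
  apply/exists_inP; apply: contraT => /exists_inPn big.
  have : \sum_(H in P) #|H :&: [set~ e]| <= #|[set~ e]|.
    apply: leq_sum_card_setI => X Y x XP YP _.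
    exact: trivIset_mem_eq tP XP YP.
  have : \sum_(H in P) #|minb D|.+2 <= \sum_(H in P) #|H :&: [set~ e]|.
    apply: leq_sum => H HP; have := big H HP; rewrite -ltnNge.
    by rewrite -setDE (setDidPl _) // disjoint_sym disjoints1 eP.
  have : #|E| = #|minb D| * bn D.
    rewrite -cardsT -(sum_card_minb plane minbT) -sum_nat_const.
    by apply: eq_bigr => B BD; rewrite setTI (minb_card BD).
  rewrite sum_nat_const cardP cardsC1 => ->.
  have := card_minb_le plane minbT; nia.
have HD := sPD H HP.
have cardH : #|H| = #|minb D|.
  have := card_member_neq Dclutter plane minbT covC bn_gt2 HD.
  by have := card_ge_minb plane minbT HD; lia.
have HC : H \in tilde D.
  apply: contraT => /(card_not_tilde plane minbT HD).
  by rewrite cardH ltnn.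
(* [P] has [bn D - 1 >= 2] members, so one is disjoint from [H], although [H] is a cover. *)
have [H' H'P neH'] : exists2 H', H' \in P & H' != H.
  have : 0 < #|P :\ H| by have := cardsD1 H P; rewrite HP; lia.
  by case/card_gt0P=> H' /setD1P[ne H'P]; exists H'.
have /set0Pn[x /setIP[xH xH']] := forall_inP (covC H HC) H' (sPD H' H'P).
by rewrite (trivIset_mem_eq tP H'P HP xH' xH) eqxx in neH'.
Qed.
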